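(* Let $t \ge 3$ be an integer and let $\mathbb{K}$ be a field. Suppose $G$ is a gap-free and $t$-claw-free graph. Then the $t$-connected ideal $J_t(G) \subset \mathbb{K}[G]$ has linear quotients. In particular, $J_t(G)$ has a linear resolution.
   Context: Graphs are finite and simple (and not assumed connected). A graph $G$ is gap-free if whenever $\{a,b\}$ and $\{c,d\}$ are disjoint edges of $G$, there is an edge of $G$ joining a vertex of $\{a,b\}$ to a vertex of $\{c,d\}$. For $t\ge 3$, $K_{1,t}$ is the graph with vertex set $\{0,1,\dots,t\}$ and edge set $\{\{0,i\} : 1\le i\le t\}$; $G$ is $t$-claw-free if it contains no induced subgraph isomorphic to $K_{1,t}$. A subset $C \subset V(G)$ is $t$-connected if $|C| = t$ and the induced subgraph $G[C]$ is connected. $\mathbb{K}[G]$ is the polynomial ring over $\mathbb{K}$ in the variables $\{x_v : v \in V(G)\}$, and $x_C = \prod_{c\in C} x_c$. The $t$-connected ideal is $J_t(G) = \langle x_C : C \subset V(G) \text{ is } t\text{-connected}\rangle \subset \mathbb{K}[G]$. A monomial ideal $I$ with minimal monomial generating set $\operatorname{mingens}(I)$ has linear quotients if there is an order $u_1 < \cdots < u_m$ on $\operatorname{mingens}(I)$ such that for each $i = 2,\dots,m$ the colon ideal $\langle u_1,\dots,u_{i-1}\rangle : \langle u_i\rangle$ is generated by a subset of the variables. The zero ideal is considered to have linear quotients. A homogeneous ideal $I$ of a polynomial ring (standard grading) generated by its degree $t$ elements has a linear resolution if its graded Betti numbers satisfy $\beta_{i,j}(I) = 0$ for all $j \ne i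 + t$. The zero ideal is also said to have a linear resolution. *)

(* Defs.v *)
From HB Require Import structures.
From mathcomp Require Import all_boot all_order all_algebra.
From mathcomp.multinomials Require Import mpoly.

Set Implicit Arguments.
Unset Strict Implicit.
Unset Printing Implicit Defensive.

Import GRing.Theory.
Local Open Scope ring_scope.

Section Graphs.
Variables (T : finType) (e : rel T).

Definition gap_free : Prop :=
  forall a b c d : T, e a b -> e c d -> [disjoint [set a; b] & [set c; d]] ->
    exists x y, [/\ x \in [set a; b], y \in [set c; d] & e x y].

(* Adjacency of K_{1,t} on {0, ..., t}, with centre 0. *)
Definition star_rel (t : nat) : rel 'I_t.+1 :=
  fun i j => (i == ord0) && (j != ord0) || (i != ord0) && (j == ord0).

Definition induced_subgraph (S : finType) (h : rel S) : Prop :=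
  exists f : S -> T, injective f /\ forall i j, e (f i) (f j) = h i j.

Definition claw_free (t : nat) : Prop := ~ induced_subgraph (@star_rel t).

Definition edges_in (C : {set T}) : rel T :=
  fun x y => [&& x \in C, y \in C & e x y].

(* The empty set would count as connected, but this is only used for t >= 3. *)
Definition t_connected (t : nat) (C : {set T}) : Prop :=
  #|C| = t /\ {in C &, forall x y, connect (edges_in C) x y}.

End Graphs.

Section Ideals.
Variables (n : nat) (K : fieldType).
Notation S := {mpoly K[n]}.

(* Ideals are represented by their membership predicates. *)
Definition eq_ideal (I J : S -> Prop) : Prop := forall p, I p <-> J p.

Definition ideal_gen (A : S -> Prop) : S -> Prop := fun p =>
  exists (k : nat) (c g : 'I_k -> S), (forall i, A (g i)) /\ p = \sum_i c i * g i.

Definition colon (I J : S -> Prop) : S -> Prop := fun p =>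
  forall q, J q -> I (p * q).

Definition monomial_gen (s : seq 'X_{1..n}) : S -> Prop :=
  ideal_gen (fun p => exists2 m, m \in s & p = 'X_[m]).

(* Monomials are given by exponent vectors; s lists without repetition a
   generating set of I that is minimal under inclusion among the sets of
   monomials generating I. *)
Definition mingens (I : S -> Prop) (s : seq 'X_{1..n}) : Prop :=
  [/\ uniq s, eq_ideal I (monomial_gen s)
    & forall s' : seq 'X_{1..n}, {subset s' <= s} ->
        eq_ideal I (monomial_gen s') -> {subset s <= s'}].

Definition linear_quotients (I : S -> Prop) : Prop :=
  exists u : seq 'X_{1..n}, mingens I u /\
    forall i, (0 < i < size u)%N ->
      exists V : {set 'I_n},
        eq_ideal
          (colon (monomial_gen (take i u)) (monomial_gen [:: nth 0%MM u i]))
          (ideal_gen (fun p => exists2 j, j \in V & p = 'X_j)).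

(* A sequence ... -> F_1 -> F_0 -> S of graded free modules of finite rank,
   F_i having a basis of rank [rk i] whose a-th element has degree [dg i a].
   Module elements are row vectors, so maps act by right multiplication. *)
Record free_seq := FreeSeq {
  rk : nat -> nat;
  dg : forall i, 'I_(rk i) -> nat;
  dif : forall i, 'M[S]_(rk i.+1, rk i);
  aug : 'cV[S]_(rk 0)
}.

(* Each entry of [dif i] is homogeneous of degree dg i.+1 a - dg i b, hence
   zero if this is negative. *)
Definition graded (F : free_seq) : Prop :=
  (forall i a b m, m \in msupp (dif F i a b) ->
     (mdeg m + dg (i := i) b)%N = dg (i := i.+1) a) /\
  (forall b, aug F b ord0 \is (dg (i := 0) b).-homog).

Definition resolves (F : free_seq) (I : S -> Prop) : Prop :=
  [/\ forall p, I p <-> exists v : 'rV[S]_(rk F 0), p = (v *m aug F) ord0 ord0,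
      forall v : 'rV[S]_(rk F 0),
        v *m aug F = 0 <-> exists w : 'rV[S]_(rk F 1), v = w *m dif F 0
    & forall i (v : 'rV[S]_(rk F i.+1)),
        v *m dif F i = 0 <-> exists w : 'rV[S]_(rk F i.+2), v = w *m dif F i.+1].

(* The image of F_{i+1} lies in (x_1, ..., x_n) F_i. *)
Definition minimal (F : free_seq) : Prop :=
  forall i a b, (dif F i a b)@_0%MM = 0.

Definition min_graded_free_resolution (F : free_seq) (I : S -> Prop) : Prop :=
  [/\ graded F, resolves F I & minimal F].

(* [beta i j] is the number of basis elements of degree j in the i-th module
   of a minimal graded free resolution of I; such a resolution is unique up to
   isomorphism, so at most one function beta satisfies this. *)
Definition graded_betti_numbers (I : S -> Prop) (beta : nat -> nat -> nat) : Prop :=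
  exists F : free_seq, min_graded_free_resolution F I /\
    forall i j, beta i j = #|[set a : 'I_(rk F i) | dg a == j]|.

Definition linear_resolution (t : nat) (I : S -> Prop) : Prop :=
  eq_ideal I (ideal_gen (fun p => I p /\ p \is t.-homog)) /\
  exists beta, graded_betti_numbers I beta /\
    forall i j : nat, j <> (i + t)%N -> beta i j = 0%N.

End Ideals.

Section ConnectedIdeal.
Variables (K : fieldType) (T : finType) (e : rel T).

(* The vertices are numbered by [enum_rank] to name the variables. *)
Definition x_set (C : {set T}) : {mpoly K[#|T|]} :=
  \prod_(c in C) 'X_(enum_rank c).

Definition connected_ideal (t : nat) : {mpoly K[#|T|]} -> Prop :=
  ideal_gen (fun p => exists2 C : {set T}, t_connected e t C & p = x_set C).

End ConnectedIdeal.

Arguments connected_ideal K {T} e t _.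

(* Main.v *)
(* Number the vertices arbitrarily. A connected t-set C is spelled by words
   c_1 c_2 ... c_t in which c_1 c_2 is an edge with c_2 < c_1 and every later
   letter is adjacent to an earlier one; order the sets by their
   lexicographically least words. Let a = a_1 a_2 ... and b = b_1 b_2 ... be the
   least words of A < B. If they have a nonempty common prefix, then the next
   letter of a is outside B by minimality of b, and appending it and completing
   inside B gives a smaller word. If a_1 < b_1 and the edge a_1 a_2 meets B,
   then this edge starts a smaller word. If it misses B, gap-freeness joins
   some c in {a_1, a_2} to b_1 or b_2. The edge c b_2 starts a smaller word; in
   the other case c can be inserted before any later letter greater than c. If
   there is none, then b_2, ..., b_t are all smaller than b_1, so any edge among
   them and c would start a smaller word; thus b_1 with the t leaves
   b_2, ..., b_t, c is an induced K_{1,t}. In all cases B can trade a vertex for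
   a vertex of A \ B and become earlier, which is the exchange property that
   characterizes linear quotients of squarefree monomial ideals generated in
   one degree.

   If I has a t-linear resolution F, u is homogeneous of degree t and I : u has
   a 1-linear resolution G, then I + (u) is resolved by the mapping cone of a
   lift G -> F of multiplication by u, whose entries can be taken homogeneous
   of degree 1. Applied to I = (x_j : j in W) and u = x_i, for which I : u = I,
   this replaces the Koszul complex; applied along the order above it resolves
   the t-connected ideal. *)

Require Import Defs.
From mathcomp Require Import all_boot all_order all_algebra.
From mathcomp.multinomials Require Import mpoly.

Set Implicit Arguments.
Unset Strict Implicit.
Unset Printing Implicit Defensive.

Import Order.TTheory GRing.Theory.

(** * Ordering the connected sets *)

Section Connectivity.
Variables (T : finType) (e : rel T).
Hypotheses (e_sym : ssrbool.symmetric e) (e_irr : irreflexive e).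

Definition connected (C : {set T}) := {in C &, forall x y, connect (edges_in e C) x y}.

Lemma connect_exit (r : rel T) (P : pred T) x y :
  connect r x y -> P x -> ~~ P y -> exists u v, [/\ P u, ~~ P v & r u v].
Proof.
move=> /connectP[p + ->]; elim: p x => [|z p IHp] x /=; first by move=> _ ->.
case/andP=> rxz pz Px; case: (boolP (P z)) => Pz; first exact: IHp.
by move=> _; exists x, z.
Qed.

Lemma connected_exit (C : {set T}) (P : pred T) x y :
  connected C -> x \in C -> y \in C -> P x -> ~~ P y ->
  exists u v, [/\ u \in C, v \in C, P u, ~~ P v & e u v].
Proof.
move=> cC xC yC Px Py; have [u [v [Pu Pv /and3P[uC vC euv]]]] := connect_exit (cC _ _ xC yC) Px Py.
by exists u, v.
Qed.

Lemma edges_in_csym (C : {set T}) : connect_sym (edges_in e C).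
Proof.
by apply: sym_connect_sym => x y; rewrite /edges_in e_sym andbCA.
Qed.

Lemma connectedU1 (C : {set T}) w u :
  connected C -> u \in C -> e u w -> connected (w |: C).
Proof.
move=> cC uC euw.
have sub x y : x \in C -> y \in C -> connect (edges_in e (w |: C)) x y.
  move=> xC yC; apply: connect_sub (cC _ _ xC yC) => {}x {}y /and3P[{}xC {}yC exy].
  by apply: connect1; rewrite /edges_in !inE xC yC !orbT.
have to_u x : x \in w |: C -> connect (edges_in e (w |: C)) x u.
  case/setU1P=> [->|xC]; last exact: sub.
  by apply: connect1; rewrite /edges_in !inE uC eqxx orbT e_sym euw.
move=> x y /to_u xu /to_u yu; apply: connect_trans xu _.
by rewrite edges_in_csym.
Qed.

(** * Growing connected sets one vertex at a time *)

Fixpoint attaches (p q : seq T) :=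
  if q is x :: q' then [&& x \notin p, has (e x) p & attaches (rcons p x) q'] else true.

Lemma attaches_cat p q1 q2 :
  attaches p (q1 ++ q2) = attaches p q1 && attaches (p ++ q1) q2.
Proof.
elim: q1 p => [|x q1 IH] p /=; first by rewrite cats0.
by rewrite IH cat_rcons !andbA.
Qed.

Lemma attaches_uniq p q : uniq p -> attaches p q -> uniq (p ++ q).
Proof.
elim: q p => [|x q IH] p Up /=; first by rewrite cats0.
case/and3P=> xp _ aq; rewrite -cat_rcons IH // rcons_uniq xp.
exact: Up.
Qed.

Lemma set_rcons (p : seq T) x : [set y in rcons p x] = x |: [set y in p].
Proof. by apply/setP=> y; rewrite !inE mem_rcons inE. Qed.

Lemma attaches_connected p q :
  connected [set x in p] -> attaches p q -> connected [set x in p ++ q].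
Proof.
elim: q p => [|x q IH] p cp /=; first by rewrite cats0.
case/and3P=> _ /hasP[u up exu] aq; rewrite -cat_rcons; apply: IH aq.
by rewrite set_rcons; apply: (connectedU1 (u := u)) => //; [rewrite inE | rewrite e_sym].
Qed.

(** While a vertex of [C] is missing, a path in [C] from the head of [p] to it leaves [p] along some
    edge, whose far end can be appended. *)
Lemma attaches_extend (C : {set T}) p m :
  connected C -> p != [::] -> uniq p -> {subset p <= C} -> size p <= m <= #|C| ->
  exists q, [/\ attaches p q, {subset p ++ q <= C} & size (p ++ q) = m].
Proof.
move=> cC; have [k] := ubnP (m - size p); elim: k p => // k IH p kP p0 Up pC /andP[].
rewrite leq_eqVlt => /orP[/eqP <- _|pm mC]; first by exists [::]; rewrite cats0.
case: p p0 kP Up pC pm => // x p _ kP Up pC pm.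
have [y yC yp] : exists2 y, y \in C & y \notin x :: p.
  apply/subsetPn; apply: contraTN (leq_trans pm mC) => /subset_leq_card Cp.
  by rewrite -leqNgt (leq_trans Cp) // card_size.
have [|u [v [uC vC up vp euv]]] :=
  @connected_exit C (fun z => z \in x :: p) x y cC (pC _ (mem_head _ _)) yC _ yp.
  exact: mem_head.
have [|||||q [aq qC sq]] := IH (rcons (x :: p) v).
- rewrite size_rcons -(ltn_predK pm) subSS -ltnS (leq_trans _ kP) // ltnS.
  by rewrite -subSn ?(ltn_predK pm) // -ltnS (ltn_predK pm).
- by [].
- by rewrite rcons_uniq vp.
- by move=> z; rewrite mem_rcons inE => /orP[/eqP->|/pC].
- by rewrite size_rcons pm.
exists (v :: q); rewrite -cat_rcons; split=> //; apply/and3P; split=> //.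
by apply/hasP; exists u => //; rewrite e_sym.
Qed.


(** * Words and their lexicographic comparison *)

Notation vrank := (@enum_rank T).

(** The comparison is decided at a differing letter, never by length, so the smaller word may be
    prolonged freely. *)
Definition lexlt (s s' : seq T) :=
  exists r x y q q', [/\ s = r ++ x :: q, s' = r ++ y :: q' & vrank x < vrank y].

(* In the least word of a set, the first letter is the first vertex that
   completes an edge with a smaller vertex of the set. *)
Definition word (s : seq T) :=
  if s is a :: b :: q then [&& e a b, vrank b < vrank a & attaches [:: a; b] q] else false.

Lemma lexlt_cat s q s' : lexlt s s' -> lexlt (s ++ q) s'.
Proof.
case=> [r [x [y [q1 [q2 [-> -> xy]]]]]].
by exists r, x, y, (q1 ++ q), q2; rewrite -catA.
Qed.

Lemma neq_edge a b : e a b -> a != b.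
Proof. by apply: contraTneq => ->; rewrite e_irr. Qed.

Lemma word_uniq s : word s -> uniq s.
Proof.
case: s => [|a [|b q]] // /and3P[eab _ /attaches_uniq]; apply.
by rewrite /= inE neq_edge.
Qed.

Lemma word_connected s : word s -> connected [set x in s].
Proof.
case: s => [|a [|b q]] // /and3P[eab _ /(@attaches_connected [:: a; b])]; apply.
have ->: [set x in [:: a; b]] = b |: [set a] by apply/setP=> x; rewrite !inE orbC.
apply: (connectedU1 (u := a)); rewrite ?inE //.
by move=> x y /set1P-> /set1P->; exact: connect0.
Qed.

Lemma word_rcons r x q : r != [::] -> word (r ++ x :: q) ->
  word (rcons r x) /\ has (e x) r.
Proof.
case: r => [|a [|b r]] //= _.
  by case/and3P=> eab ab _; rewrite eab ab e_sym eab.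
case/and3P=> -> ->; rewrite -cat_rcons !attaches_cat => /andP[ar _].
by split=> //; move: ar; rewrite -cats1 attaches_cat /= => /and4P[_ _].
Qed.

Lemma word_extend (C : {set T}) s t :
  connected C -> word s -> {subset s <= C} -> size s <= t <= #|C| ->
  exists q, [/\ word (s ++ q), {subset s ++ q <= C} & size (s ++ q) = t].
Proof.
move=> cC ws sC st; have s0 : s != [::] by case: (s) ws.
have [q [aq qC sq]] := attaches_extend cC s0 (word_uniq ws) sC st.
exists q; split=> //; case: s ws aq {sC st s0 qC sq} => [|a [|b s]] //=.
by case/and3P=> -> -> as_; rewrite attaches_cat as_.
Qed.

Lemma word2 a b : e a b -> exists s, [/\ word s, s =i [:: a; b] & size s = 2].
Proof.
move=> eab; have := neq_edge eab.
rewrite -(inj_eq enum_rank_inj) -(inj_eq val_inj) neq_ltn => /orP[] lt_ab.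
  by exists [:: b; a]; split=> //= [|x]; [rewrite e_sym eab lt_ab | rewrite !inE orbC].
by exists [:: a; b]; split=> //=; rewrite eab lt_ab.
Qed.

Lemma connected_word (C : {set T}) t : connected C -> #|C| = t -> 1 < t ->
  exists s, [/\ word s, size s = t & [set x in s] = C].
Proof.
move=> cC <- C2; have /card_gt1P[x [y [xC yC xy]]] := C2.
have [|u [v [uC vC Pu Pv euv]]] := @connected_exit C (pred1 x) x y cC xC yC (eqxx _).
  by rewrite /= eq_sym.
have [s [ws sE s2]] := word2 euv.
have sC : {subset s <= C} by move=> z; rewrite sE !inE => /orP[] /eqP->.
have [|q [wq qC sq]] := @word_extend C s #|C| cC ws sC; first by rewrite s2 C2 leqnn.
exists (s ++ q); split=> //; apply/eqP; rewrite eqEcard; apply/andP; split.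
  by apply/subsetP=> z; rewrite inE => /qC.
by rewrite cardsE (card_uniqP (word_uniq wq)) sq.
Qed.

(** * The exchange property at a least word *)

Section Exchange.
Variables (t : nat) (b : seq T).
Hypotheses (t_gt1 : 1 < t) (wb : word b) (sb : size b = t).
Hypothesis b_min : forall s, word s -> size s = t -> s =i b -> ~ lexlt s b.

(** For [w] outside [b], counting letters shows that [s] spells [b] with one letter traded for
    [w]. *)
Let exchangeable w :=
  exists s, [/\ word s, size s = t, lexlt s b, w \in s & {subset s <= w :: b}].

Let cB : connected [set x in b].
Proof. exact: word_connected. Qed.

Let cardB : #|[set x in b]| = t.
Proof. by rewrite cardsE (card_uniqP (word_uniq wb)). Qed.

(** Completed inside [b], such a [p] would spell the same set by a smaller word, against [b_min]. *)
Lemma no_smaller_subword p : word p -> size p <= t -> {subset p <= b} -> ~ lexlt p b.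
Proof.
move=> wp sp pb lp.
have [x||q [wq qb sq]] := @word_extend [set x in b] p t cB wp.
- by move/pb; rewrite inE.
- by rewrite sp cardB leqnn.
apply: (@b_min (p ++ q)) => //; last exact: lexlt_cat.
have /uniq_min_size[] // : {subset p ++ q <= b} by move=> x /qb; rewrite inE.
  exact: word_uniq.
by rewrite sq sb.
Qed.

(** The edge from [w] to [u] keeps [b] connected when [w] is added, so [p] grows to [t] letters
    there, and its comparison with [b] is already settled. *)
Lemma exchangeableI p w u :
  word p -> size p <= t -> lexlt p b -> w \in p -> {subset p <= w :: b} ->
  u \in b -> e w u -> exchangeable w.
Proof.
move=> wp sp lp wp' pb ub ewu.
have cC : connected (w |: [set x in b]).
  by apply: (connectedU1 (u := u)); rewrite ?inE // e_sym.
have [x||q [wq qb sq]] := word_extend (t := t) cC wp.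
- by move/pb; rewrite !inE.
- by apply/andP; split; [exact: sp | rewrite -cardB subset_leq_card ?subsetUr].
exists (p ++ q); split=> //; first exact: lexlt_cat.
  by rewrite mem_cat wp'.
by move=> x /qb; rewrite !inE.
Qed.


(** Whichever end comes first, it is below the first letter of [b]; [d \in b] makes [b] nonempty, so
    [head] does return that letter. *)
Lemma exchangeable_edge c d : e c d -> vrank c < vrank (head c b) -> vrank d < vrank (head c b) ->
  c \notin b -> d \in b -> exchangeable c.
Proof.
move=> ecd cb db cNb d_b; have [s [ws sE s2]] := word2 ecd.
apply: (@exchangeableI s c d) => //; first by rewrite s2.
- case: s ws sE s2 => [|x [|y []]] // _ sE _; case: b db cb d_b => [|z b'] // db cb _.
  exists [::], x, z, [:: y], b'; split=> //.
  by have := mem_head x [:: y]; rewrite sE !inE => /orP[] /eqP->.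
- by rewrite sE mem_head.
- by move=> x; rewrite sE !inE => /orP[/eqP->|/eqP->]; rewrite ?eqxx ?d_b ?orbT.
Qed.

Lemma no_smaller_edge c d : e c d -> c \in b -> d \in b ->
  vrank c < vrank (head c b) -> vrank d < vrank (head c b) -> False.
Proof.
move=> ecd c_b d_b cb db; have [s [ws sE s2]] := word2 ecd.
apply: (@no_smaller_subword s) => //; first by rewrite s2.
- by move=> x; rewrite sE !inE => /orP[] /eqP->.
- case: s ws sE s2 => [|x [|y []]] // _ sE _; case: b db cb d_b => [|z b'] // db cb _.
  exists [::], x, z, [:: y], b'; split=> //.
  by have := mem_head x [:: y]; rewrite sE !inE => /orP[] /eqP->.
Qed.

Lemma star_exchange c : claw_free e t -> c \notin b -> e c (head c b) ->
  vrank c < vrank (head c b) -> exchangeable c.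
Proof.
move=> hclaw cNb; case def_b: b => [|y q] /=; first by move: (sb) t_gt1; rewrite def_b => <-.
move=> ecy cy; have yb : y \in b by rewrite def_b mem_head.
have qb x : x \in q -> x \in b by rewrite def_b inE orbC => ->.
have c_q x : x \in q -> x != c by move=> /qb; apply: contraTneq => ->.
have [/hasP[z zq cz]|/hasPn no_bigger] := boolP (has (fun z => vrank c < vrank z) q).
  case/splitPr: zq def_b => q1 q2 def_b {qb c_q}.
  (* The word is cut just before [z] and continued by [c], attached through [y]; the first
     difference is then [c] against [z]. *)
  apply: (@exchangeableI (rcons (y :: q1) c) c y); rewrite // ?mem_rcons ?mem_head //.
  (* With [q1] empty, [c] becomes the second letter and must lie below [y]. *)
  - case: q1 def_b => [|x q1] def_b; first by rewrite /= e_sym ecy cy.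
    move: (wb) cNb; rewrite def_b /= => /and3P[-> ->] /=.
    rewrite -cats1 !attaches_cat /= => /andP[-> _] /=.
    by rewrite !inE !mem_cat ecy !negb_or /= => /and4P[-> -> -> _].
  - by rewrite -sb def_b size_rcons /= size_cat /= addnS !ltnS leq_addr.
  - by exists (y :: q1), c, z, [::], q2; rewrite cats1 def_b.
  - move=> x; rewrite mem_rcons def_b /= !inE mem_cat => /or3P[] ->; by rewrite ?orbT.
have {no_bigger} q_small x : x \in q -> vrank x < vrank y.
  by move=> xq; rewrite (leq_ltn_trans _ cy) // leqNgt no_bigger.
have [/hasP[z zq ecz]|/hasPn c_indep] := boolP (has (e c) q).
  by apply: (exchangeable_edge ecz) => //; rewrite ?qb // def_b //= q_small.
(* Two adjacent letters of [q], both below [y], would start a smaller word in the same set. *)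
have q_indep : {in q &, forall u v, ~~ e u v}.
  move=> u v uq vq; apply/negP=> euv.
  by apply: (no_smaller_edge euv); rewrite ?qb // def_b /= q_small.
have Ub : uniq (y :: q) by rewrite -def_b word_uniq.
(* By connectivity some edge leaves [u] inside [b], and it can only end at [y]. *)
have y_adj u : u \in q -> e y u.
  move=> uq; have uy : y != u by apply: contraTneq uq => <-; case/andP: Ub.
  have [||v [v' [_ + /eqP-> v'u euv']]] := @connected_exit [set x in b] (pred1 u) u y cB _ _ (eqxx u) uy.
  - by rewrite inE qb.
  - by rewrite inE.
  rewrite inE def_b inE => /orP[/eqP<-|v'q]; first by rewrite e_sym.
  by have := q_indep _ _ uq v'q; rewrite euv'.
(* Position 0 carries the centre [y]; the [t] leaves are [c] and the [t - 1] letters of [q]. *)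
case: hclaw; pose s := y :: c :: q.
have sz_s : size s = t.+1 by rewrite -sb def_b.
have Us : uniq s.
  move: Ub cNb; rewrite def_b /s /= !inE !negb_or [c == y]eq_sym.
  by move=> /andP[-> ->] /andP[-> ->].
exists (fun i : 'I_t.+1 => nth y s i); split.
  by move=> i j /eqP; rewrite nth_uniq ?sz_s ?ltn_ord // => /eqP/val_inj.
have y_nbr k : k < t -> e y (nth y (c :: q) k).
  case: k => [|k] kt /=; first by rewrite e_sym.
  by rewrite y_adj // mem_nth // -ltnS -[(size q).+1]/(size (y :: q)) -def_b sb.
have mem_leaf k : k < t -> nth y (c :: q) k \in c :: q.
  by move=> kt; rewrite mem_nth // -[size _]/(size (y :: q)) -def_b sb.
have leaves_indep : {in c :: q &, forall u v, ~~ e u v}.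
  move=> u v; rewrite !inE => /orP[/eqP->|uq] /orP[/eqP->|vq].
  - by rewrite e_irr.
  - exact: c_indep.
  - by rewrite e_sym c_indep.
  - exact: q_indep.
move=> [[|i] ilt] [[|j] jlt]; rewrite /star_rel -!(inj_eq val_inj) /=.
- by rewrite e_irr.
- exact: y_nbr.
- by rewrite e_sym; apply: y_nbr.
- by apply/negbTE/leaves_indep; apply: mem_leaf.
Qed.

Lemma exchange a : gap_free e -> claw_free e t -> word a -> size a = t -> lexlt a b ->
  exists w, [/\ w \in a, w \notin b & exchangeable w].
Proof.
move=> hgap hclaw wa sa [r [x [y [qa [qb [def_a def_b xy]]]]]].
have [r0|r_n0] := eqVneq r [::].
  case: qa => [|x2 qa] in def_a; first by move: wa; rewrite def_a r0.
  case: qb => [|y2 qb] in def_b; first by move: wb; rewrite def_b r0.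
  rewrite {r}r0 /= in def_a def_b.
  have /and3P[exx2 x2x _] : word (x :: x2 :: qa) by rewrite -def_a.
  have /and3P[eyy2 y2y _] : word (y :: y2 :: qb) by rewrite -def_b.
  have x2y := ltn_trans x2x xy.
  have hb z : head z b = y by rewrite def_b.
  have edge c d : e c d -> vrank c < vrank y -> vrank d < vrank y -> c \in a -> c \notin b -> d \in b ->
      exists w, [/\ w \in a, w \notin b & exchangeable w].
    by move=> ecd cy dy ca cNb db; exists c; split=> //; apply: (exchangeable_edge ecd); rewrite ?hb.
  have [xb|xNb] := boolP (x \in b).
    have [x2b|x2Nb] := boolP (x2 \in b).
      by case: (no_smaller_edge exx2); rewrite ?hb.
    by apply: (edge x2 x); rewrite // 1?e_sym // def_a !inE eqxx orbT.
  have [x2b|x2Nb] := boolP (x2 \in b).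
    by apply: (edge x x2); rewrite // def_a mem_head.
  have y_b : y \in b by rewrite def_b mem_head.
  have y2_b : y2 \in b by rewrite def_b !inE eqxx orbT.
  have [|c [d [cf dg ecd]]] := hgap x x2 y y2 exx2 eyy2.
    rewrite -setI_eq0; apply/eqP/setP=> z; rewrite !inE; apply/negP=> /andP[/orP[]/eqP-> /orP[]/eqP zE];
      by rewrite ?zE ?y_b ?y2_b in xNb x2Nb.
  have [ca cNb cy] : [/\ c \in a, c \notin b & vrank c < vrank y].
    by move: cf; rewrite def_a !inE => /orP[] /eqP->; rewrite eqxx ?orbT.
  (* An edge from [c] to [y2] starts a smaller word because [y2] is below [y]; an edge from [c] to
     [y] calls for the star argument. *)
  case/set2P: dg ecd => -> ecd; last exact: (edge c y2).
  by exists c; split=> //; apply: star_exchange; rewrite ?hb.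
(* With a common prefix [r], the letter [x] itself is traded in: it attaches to [r], and minimality
   of [b] keeps it outside [b]. *)
have [w_rx /hasP[u ur exu]] : word (rcons r x) /\ has (e x) r.
  by apply: (word_rcons (q := qa)); rewrite -?def_a.
have u_b : u \in b by rewrite def_b mem_cat ur.
have r_b z : z \in r -> z \in b by rewrite def_b mem_cat => ->.
have lex_rx : lexlt (rcons r x) b.
  by exists r, x, y, [::], qb; rewrite cats1.
have sz_rx : size (rcons r x) <= t.
  by rewrite size_rcons -sa def_a size_cat /= addnS ltnS leq_addr.
have xNb : x \notin b.
  apply/negP=> xb; apply: (no_smaller_subword w_rx sz_rx) lex_rx => z.
  by rewrite mem_rcons inE => /orP[/eqP->|/r_b].
exists x; split=> //; first by rewrite def_a mem_cat mem_head orbT.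
apply: (exchangeableI w_rx sz_rx lex_rx _ _ u_b exu); first by rewrite mem_rcons mem_head.
by move=> z; rewrite mem_rcons !inE => /orP[->|/r_b->]; rewrite ?orbT.
Qed.

End Exchange.

(** * Sorting the connected sets by their least words *)

Definition lexle (s s' : seq T) := ((map vrank s : seqlexi 'I_#|T|) <= map vrank s')%O.

Lemma lexlt_total s s' : size s = size s' -> s != s' -> lexlt s s' \/ lexlt s' s.
Proof.
elim: s s' => [|x s IHs] [|y s'] //= [/IHs{}IHs].
have [->|xy _] := eqVneq x y; last first.
  move: xy; rewrite -(inj_eq enum_rank_inj) -(inj_eq val_inj) neq_ltn.
  by case/orP=> lt_xy; [left; exists [::], x, y, s, s' | right; exists [::], y, x, s', s].
rewrite eqseq_cons eqxx => /IHs.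
by case=> -[r [u [v [q [q' [-> -> uv]]]]]]; [left|right]; exists (y :: r), u, v, q, q'.
Qed.

(** Together with [lexlt_total], this identifies [lexlt] with the strict part of the total order
    [lexle] on words of equal length. *)
Lemma lexlt_Nlexle s s' : lexlt s s' -> ~~ lexle s' s.
Proof.
case=> [r [x [y [q [q' [-> -> xy]]]]]]; rewrite /lexle.
elim: r => [|z r IHr] /=; rewrite lexi_cons; last by rewrite lexx.
by rewrite negb_and (leNgt (vrank y)) negbK; apply/orP; left.
Qed.

Lemma connected_sets_order t : 1 < t -> gap_free e -> claw_free e t ->
  exists u : seq {set T},
    [/\ uniq u, forall C, C \in u <-> t_connected e t C
      & forall i A, i < size u -> A \in take i u ->
        exists w, [/\ w \in A, w \notin nth set0 u i
          & exists2 B, B \in take i u & w \in B /\ B \subset w |: nth set0 u i]].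
Proof.
move=> t_gt1 hgap hclaw.
pose st (s : seq T) := [set x in s].
pose ws := sort lexle [seq val s | s <- enum {: t.-tuple T} & word (val s)].
have lexle_trans : transitive lexle by move=> ? ? ?; apply: le_trans.
have lexle_refl : reflexive lexle by move=> ?; apply: lexx.
have ws_sorted : sorted lexle ws.
  by apply: sort_sorted => ? ?; apply: le_total.
have mem_ws s : s \in ws = word s && (size s == t).
  rewrite mem_sort; apply/mapP/andP=> [[s' + ->]|[ws_ sz]].
    by rewrite mem_filter size_tuple eqxx => /andP[].
  by exists (Tuple sz) => //; rewrite mem_filter mem_enum ws_.
(* As [ws] is sorted, the first word spelling [C] is its least one. *)
pose key C := find (fun s => st s == C) ws.
pose conn := [seq C <- enum {set T} | C \in map st ws].
have mem_conn C : C \in conn = (C \in map st ws) by rewrite mem_filter mem_enum andbT.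
have keyP C : C \in conn ->
    [/\ key C < size ws, st (nth [::] ws (key C)) = C & nth [::] ws (key C) \in ws].
  rewrite mem_conn => /mapP[s sws ->].
  have hs : has (fun s' => st s' == st s) ws by apply/hasP; exists s.
  by split; [rewrite -has_find | apply/eqP/(nth_find [::] hs) | rewrite mem_nth // -has_find].
have conn_tconn C : C \in conn <-> t_connected e t C.
  rewrite mem_conn; split=> [/mapP[s + ->]|[sC cC]].
    rewrite mem_ws => /andP[wS /eqP <-]; split; last exact: word_connected.
    by rewrite cardsE (card_uniqP (word_uniq wS)).
  have [s [wS sz <-]] := connected_word cC sC t_gt1.
  by rewrite map_f // mem_ws wS sz eqxx.
pose u := sort (relpre key leq) conn.
have u_uniq : uniq u by rewrite sort_uniq filter_uniq // enum_uniq.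
have mem_u C : C \in u = (C \in conn) by rewrite mem_sort.
have u_sorted : sorted (relpre key leq) u by apply: sort_sorted => ? ?; apply: leq_total.
have key_inj : {in conn &, injective key}.
  by move=> A B /keyP[_ eA _] /keyP[_ eB _] eAB; rewrite -eA eAB eB.
have rel_trans : transitive (relpre key leq) by move=> ? ? ?; apply: leq_trans.
have rel_refl : reflexive (relpre key leq) by move=> ?; apply: leqnn.
have take_key i A : i < size u ->
    (A \in take i u) = (A \in conn) && (key A < key (nth set0 u i)).
  move=> iu; have [Ac|] := boolP (A \in conn); last first.
    by rewrite -mem_u; apply: contraNF => /mem_take.
  have Au : A \in u by rewrite mem_u.
  have ku : index A u < size u by rewrite index_mem.
  rewrite in_take //= -{2}(nth_index set0 Au); apply/idP/idP=> [ki|]; last first.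
    apply: contraTT; rewrite -!leqNgt.
    exact: (sorted_leq_nth rel_trans rel_refl set0 u_sorted).
  have := sorted_ltn_nth rel_trans set0 u_sorted _ _ ku iu ki.
  rewrite /= leq_eqVlt => /predU1P[/key_inj eq_ki|//].
  by move: ki; rewrite -(index_uniq set0 iu u_uniq) -eq_ki ?nth_index ?ltnn // -mem_u mem_nth.
exists u; split=> // [C|i A iu]; first by rewrite mem_u.
set B := nth set0 u i; rewrite take_key // -/B => /andP[Ac ltAB].
have Bc : B \in conn by rewrite -mem_u mem_nth.
have [szA stA wA] := keyP A Ac; have [szB stB wB] := keyP B Bc.
set a := nth _ _ _ in stA wA; set b := nth _ _ _ in stB wB.
have [[wa sa] [wb sb]] : (word a /\ size a = t) /\ (word b /\ size b = t).
  by move: wA wB; rewrite !mem_ws => /andP[-> /eqP->] /andP[-> /eqP->].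
(* [s] precedes [b] in [ws], and the first word spelling [st s] comes no later than [s]. *)
have lt_key s : word s -> size s = t -> lexlt s b -> key (st s) < key B.
  move=> wS sz lt_sb; rewrite ltnNge; apply/negP=> le_B.
  have sws : s \in ws by rewrite mem_ws wS sz eqxx.
  case/negP: (lexlt_Nlexle lt_sb); rewrite -(nth_index [::] sws).
  apply: (sorted_leq_nth lexle_trans lexle_refl) => //; first by rewrite inE index_mem.
  apply: leq_trans le_B _; rewrite leqNgt; apply/negP=> /(before_find [::]).
  by rewrite nth_index // eqxx.
have lt_ab : lexlt a b.
  case: (@lexlt_total a b) => //; first by rewrite sa sb.
    by apply: contraTneq ltAB => ab; rewrite -stA -stB ab ltnn.
  move/lexlt_Nlexle/negP; case.
  exact: (sorted_ltn_nth lexle_trans).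
(* The first goal is the minimality of [b]: a smaller spelling would give [key B < key B]. *)
have [s wS sz sE lt_sb|w [wa' wNb [s [wS sz lt_sb wS' sS]]]] :=
    exchange t_gt1 wb sb _ hgap hclaw wa sa lt_ab.
  have := lt_key s wS sz lt_sb; rewrite -stB.
  have ->: st s = st b by apply/setP=> x; rewrite !inE sE.
  by rewrite ltnn.
exists w; split; rewrite -?stA -?stB ?inE //.
exists (st s); first by rewrite take_key // -/B lt_key // mem_conn map_f ?mem_ws ?wS ?sz ?eqxx.
by split; rewrite ?inE //; apply/subsetP=> x; rewrite !inE => /sS; rewrite inE.
Qed.

End Connectivity.

(** * Resolving ideals with linear quotients *)

Local Open Scope ring_scope.

Section LinearResolutions.
Variables (n : nat) (K : fieldType).
Notation S := {mpoly K[n]}.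

(** * Homogeneous components and homogeneous matrices *)

Lemma pihomogM d e (p q : S) :
  q \is e.-homog -> pihomog mdeg (d + e) (p * q) = pihomog mdeg d p * q.
Proof.
move=> hq; rewrite [p]mpolyE mulr_suml !raddf_sum /= mulr_suml; apply: eq_bigr => m _.
rewrite -scalerAl !linearZ /= -scalerAl pihomogX; congr (_ *: _).
have hm : 'X_[m] * q \is (mdeg m + e).-homog by rewrite dhomogM // dhomogX.
case: eqVneq => [<-|dm]; first by rewrite pihomog_dE.
by rewrite mul0r (pihomog_ne0 _ hm) // eqn_add2r.
Qed.

Definition homog_mx d r s (M : 'M[S]_(r, s)) := [forall i, forall j, M i j \is d.-homog].

Lemma homog_mxP d r s (M : 'M[S]_(r, s)) :
  reflect (forall i j, M i j \is d.-homog) (homog_mx d M).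
Proof. by apply: (iffP forallP) => h i; apply/forallP. Qed.

Lemma homog_mulmx d e r s q (M : 'M[S]_(r, s)) (N : 'M[S]_(s, q)) :
  homog_mx d M -> homog_mx e N -> homog_mx (d + e) (M *m N).
Proof.
move=> /homog_mxP hM /homog_mxP hN; apply/homog_mxP=> i j; rewrite mxE.
by apply: rpred_sum => k _; rewrite dhomogM.
Qed.

Lemma homog_opp d r s (M : 'M[S]_(r, s)) : homog_mx d M -> homog_mx d (- M).
Proof. by move/homog_mxP=> hM; apply/homog_mxP=> i j; rewrite mxE rpredN. Qed.

(** Arbitrary preimages of the rows can be replaced by their components of degree [d], since
    multiplication by [M] raises degrees by exactly [e]. *)
Lemma homog_lift d e r s q (M : 'M[S]_(s, q)) (N : 'M[S]_(r, q)) :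
  homog_mx e M -> homog_mx (d + e) N -> (forall i, exists w, row i N = w *m M) ->
  exists2 X : 'M[S]_(r, s), homog_mx d X & X *m M = N.
Proof.
move=> /homog_mxP hM /homog_mxP hN /fin_all_exists[W WN].
exists (\matrix_(i, j) pihomog mdeg d (W i ord0 j)).
  by apply/homog_mxP=> i j; rewrite mxE pihomogP.
apply/matrixP=> i j; rewrite mxE -(pihomog_dE (hN i j)).
have ->: N i j = (W i *m M) ord0 j by rewrite -WN mxE.
rewrite mxE raddf_sum /=; apply: eq_bigr => k _.
by rewrite mxE -(pihomogM _ _ (hM k j)).
Qed.

(** Builds chain maps step by step. [P] is the invariant under which a next term exists; boolean
    predicates on choice types let [xchoose] pick it. *)
Lemma dependent_choice (A : nat -> choiceType) (P : forall i, pred (A i))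
    (R : forall i, A i -> A i.+1 -> bool) :
  forall x0, P 0 x0 -> (forall i x, P i x -> exists y, P i.+1 y && R i x y) ->
  exists f : forall i, A i, f 0 = x0 /\ forall i, R i (f i) (f i.+1).
Proof.
move=> x0 P0 PS.
pose f := fix f i : {x : A i | P i x} :=
  match i with
  | 0 => exist _ x0 P0
  | j.+1 => let ex := PS j (sval (f j)) (svalP (f j)) in
            exist _ (xchoose ex) (proj1 (andP (xchooseP ex)))
  end.
exists (fun i => sval (f i)); split=> // i.
by rewrite /=; set ex := PS _ _ _; case/andP: (xchooseP ex).
Qed.

(** * Exactness and block matrices *)

Definition exact_at r s q (D1 : 'M[S]_(r, s)) (D0 : 'M[S]_(s, q)) :=
  forall v : 'rV_s, v *m D0 = 0 <-> exists w : 'rV_r, v = w *m D1.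

Lemma exact_at_comp r s q (D1 : 'M[S]_(r, s)) (D0 : 'M[S]_(s, q)) :
  exact_at D1 D0 -> D1 *m D0 = 0.
Proof.
move=> ex; apply/row_matrixP=> i; rewrite row_mul row0.
by apply/(ex _); exists (delta_mx ord0 i); rewrite -rowE.
Qed.

(** Once [v2 = w *m E1], subtracting [w] times the lower block row leaves an element killed by [D0],
    hence in the image of [D1]. The last hypothesis asks only for this [w], so the augmented end of
    a cone is covered too. *)
Lemma exact_at_cone a b c p q (D1 : 'M[S]_(a, b)) (D0 : 'M[S]_(b, c))
    (P1 : 'M[S]_(p, b)) (E1 : 'M[S]_(p, q)) (P0 : 'M[S]_(q, c)) :
  exact_at D1 D0 -> P1 *m D0 + E1 *m P0 = 0 ->
  (forall (v1 : 'rV_b) (v2 : 'rV_q), v1 *m D0 + v2 *m P0 = 0 -> exists w, v2 = w *m E1) ->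
  exact_at (block_mx D1 0 P1 E1) (col_mx D0 P0).
Proof.
move=> exD PE exE v; rewrite -[v]hsubmxK mul_row_col; split=> [v0|[w]].
  have [w2 v2E] := exE _ _ v0; move: v0; rewrite v2E.
  have : lsubmx v *m D0 - w2 *m P1 *m D0 = lsubmx v *m D0 + w2 *m E1 *m P0.
    by congr (_ + _); rewrite -!mulmxA -mulmxN; congr (_ *m _); apply/eqP; rewrite eq_sym -addr_eq0 addrC PE.
  rewrite -mulmxBl => <- /exD[w1 /eqP]; rewrite subr_eq => /eqP ->.
  exists (row_mx w1 w2); rewrite mul_row_block mulmx0 add0r.
  by [].
rewrite -[w]hsubmxK mul_row_block mulmx0 add0r => /eq_row_mx[-> ->].
rewrite mulmxDl -!mulmxA (exact_at_comp exD) mulmx0 add0r.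
by rewrite -mulmxDr PE mulmx0.
Qed.

Lemma exact_at_block a b c p q r (D1 : 'M[S]_(a, b)) (D0 : 'M[S]_(b, c))
    (P1 : 'M[S]_(p, b)) (E1 : 'M[S]_(p, q)) (P0 : 'M[S]_(q, c)) (E0 : 'M[S]_(q, r)) :
  exact_at D1 D0 -> exact_at E1 E0 -> P1 *m D0 + E1 *m P0 = 0 ->
  exact_at (block_mx D1 0 P1 E1) (block_mx D0 0 P0 E0).
Proof.
move=> exD exE PE; apply: exact_at_cone.
- move=> v; rewrite mul_mx_row mulmx0 -exD; split=> [|->]; last by rewrite row_mx0.
  by rewrite -row_mx0 => /eq_row_mx[].
- by rewrite !mul_mx_row mulmx0 add_row_mx add0r PE (exact_at_comp exE) row_mx0.
- move=> v1 v2; rewrite !mul_mx_row mulmx0 add_row_mx add0r -row_mx0.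
  by case/eq_row_mx=> _ /exE.
Qed.

Lemma homog_block d a b p q (D : 'M[S]_(a, b)) (P : 'M[S]_(p, b)) (E : 'M[S]_(p, q)) :
  homog_mx d D -> homog_mx d P -> homog_mx d E -> homog_mx d (block_mx D 0 P E).
Proof.
move=> /homog_mxP hD /homog_mxP hP /homog_mxP hE; apply/homog_mxP=> i j.
rewrite /block_mx !mxE; case: split => k; rewrite mxE; case: split => l //.
by rewrite mxE rpred0.
Qed.

(** Entries of degree 1 have no constant term, so such a resolution is minimal and its basis degrees
    give the Betti numbers. *)
Record linear_free_resolution t (F : free_seq n K) (I : S -> Prop) : Prop := {
  lin_resolves : resolves F I;
  lin_dg : forall i a, dg (f := F) (i := i) a = (i + t)%N;
  lin_dif : forall i, homog_mx 1 (dif F i);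
  lin_aug : homog_mx t (aug F)
}.

Lemma eq_linear_free_resolution t F I J : eq_ideal I J ->
  linear_free_resolution t F I -> linear_free_resolution t F J.
Proof. by move=> IJ [[r1 r2 r3] hd hdif ha]; split=> //; split=> // p; rewrite -IJ. Qed.

Lemma zero_linear_free_resolution t :
  exists F, linear_free_resolution t F (fun p => p = 0).
Proof.
exists (@FreeSeq n K (fun=> 0) (fun _ _ => t) (fun _ => 0) 0); split=> /=.
- split=> [p||i] /=.
  + split=> [->|[v ->]]; last by rewrite mulmx0 mxE.
    by exists 0; rewrite mulmx0 mxE.
  + by move=> v; split=> _; [exists 0; rewrite thinmx0 [RHS]thinmx0 | rewrite mulmx0].
  + by move=> v; split=> _; [exists 0; rewrite thinmx0 [RHS]thinmx0 | rewrite mulmx0].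
- by move=> i [].
- by move=> i; apply/homog_mxP=> [[]].
- by apply/homog_mxP=> [[]].
Qed.

(** * Mapping cones *)

Section MappingCone.
Variables (F G : free_seq n K) (t : nat) (u : S) (phi : forall i, 'M[S]_(rk G i, rk F i)).

(** [G] is shifted up by one position, and the ring, as target of [aug G], fills position 0; hence
    the summand 1. *)
Definition cone_rk i := if i is j.+1 then (rk F j.+1 + rk G j)%N else (rk F 0 + 1)%N.

Definition cone_dif i : 'M[S]_(cone_rk i.+1, cone_rk i) :=
  match i return 'M[S]_(cone_rk i.+1, cone_rk i) with
  | 0 => block_mx (dif F 0) 0 (phi 0) (aug G)
  | j.+1 => block_mx (dif F j.+1) 0 (phi j.+1) (dif G j)
  end.

Definition cone : free_seq n K :=
  @FreeSeq n K cone_rk (fun i _ => (i + t)%N) cone_dif (col_mx (aug F) u%:M).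

End MappingCone.

Lemma mx11_addM r (v : 'rV[S]_r) (D : 'cV_r) (w : 'rV_1) (u : S) :
  (v *m D + w *m u%:M) ord0 ord0 = (v *m D) ord0 ord0 + w ord0 ord0 * u.
Proof. by rewrite mul_mx_scalar mxE [X in _ + X]mxE mulrC. Qed.

(** A basis element of [G] in position [i] has degree [i + 1]; multiplication by [u] adds [t] and
    the cone moves it to position [i + 1], so the cone stays linear. The lift [phi] starts from
    [- u] and anticommutes with the differentials, so the blocks carry no signs. *)
Lemma cone_linear_free_resolution t F G (u : S) (I : S -> Prop) :
  u \is t.-homog -> linear_free_resolution t F I ->
  linear_free_resolution 1 G (fun p => I (p * u)) ->
  exists H, linear_free_resolution t H (fun p => exists q, I (p - q * u)).
Proof.
move=> hu [[rF rF0 rFS] dgF hF hauF] [[rG rG0 rGS] dgG hG hauG].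
have hu1 : homog_mx t (u%:M : 'M[S]_1).
  by apply/homog_mxP=> i j; rewrite mxE !ord1 mulr1n.
have IN p : I p -> I (- p) by move=> /rF[v ->]; apply/rF; exists (- v); rewrite mulNmx [RHS]mxE.
pose dF i : 'M[S]_(rk F i, if i is j.+1 then rk F j else 1) :=
  match i with 0 => aug F | j.+1 => dif F j end.
have exF i : exact_at (dif F i) (dF i) by case: i => [|i]; [exact: rF0 | exact: rFS].
have dG_dG i : dif G i.+1 *m dif G i = 0 by apply: exact_at_comp; exact: rGS.
have dG_aG : dif G 0 *m aug G = 0 by apply: exact_at_comp; exact: rG0.
have [phi0 hphi0 /eqP phi0E] : exists2 f : 'M[S]_(rk G 0, rk F 0),
    homog_mx 1 f & f *m aug F == - (aug G *m u%:M).
  have [|i|f hf fE] := @homog_lift 1 t _ _ _ (aug F) (- (aug G *m u%:M)) hauF.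
  - by apply: homog_opp; apply: homog_mulmx.
  - have /rF[v vE] : I (- (aug G i ord0 * u)).
      apply: IN; apply/rG; exists (delta_mx ord0 i).
      by rewrite -rowE mxE.
    exists v; apply/rowP=> j; rewrite ord1 -vE !mxE big_ord1 !mxE eqxx mulr1n.
    by rewrite !ord1.
  by exists f; rewrite // fE.
(* The invariant puts the rows of [dif G i *m f] in the kernel of [dF i], so exactness of [F]
   provides the next map. *)
pose P i (f : 'M[S]_(rk G i, rk F i)) := homog_mx 1 f && (dif G i *m f *m dF i == 0).
pose R i (f : 'M[S]_(rk G i, rk F i)) (f' : 'M[S]_(rk G i.+1, rk F i.+1)) :=
  homog_mx 1 f' && (f' *m dif F i == - (dif G i *m f)).
have P0 : P 0 phi0 by rewrite /P hphi0 -mulmxA /= phi0E mulmxN mulmxA dG_aG mul0mx oppr0.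
have [|phi [phi_0 phiS]] := dependent_choice (R := R) P0.
  move=> i f /andP[hf /eqP f0].
  have [|k|f' hf' fE] := @homog_lift 1 1 _ _ _ (dif F i) (- (dif G i *m f)) (hF i).
  - by apply: homog_opp; apply: (homog_mulmx (hG i) hf).
  - by apply/(exF i); rewrite -row_mul mulNmx f0 oppr0 row0.
  exists f'; rewrite /P /R hf' fE eqxx andbT /= -mulmxA fE mulmxN mulmxA dG_dG.
  by rewrite mul0mx oppr0 eqxx.
rewrite -phi_0 in hphi0 phi0E.
have hphi i : homog_mx 1 (phi i) by case: i => // i; case/andP: (phiS i).
have phiE i : phi i.+1 *m dif F i = - (dif G i *m phi i).
  by case/andP: (phiS i) => _ /eqP.
exists (cone t u phi); split=> //=.
- split.
  + move=> p /=; split=> [[q /rF[v pE]]|[v ->]].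
      exists (row_mx v q%:M); rewrite mul_row_col mx11_addM -pE.
      by rewrite mxE eqxx mulr1n subrK.
    exists (rsubmx v ord0 ord0); apply/rF; exists (lsubmx v).
    by rewrite -{1}[v]hsubmxK mul_row_col mx11_addM addrK.
  + apply: exact_at_cone; first exact: rF0.
      by rewrite phi0E addNr.
    (* In a relation between [u] and the generators of [I], the coefficient of [u] lies in the colon
       ideal, which [aug G] generates. *)
    move=> v1 v2 v0; have /rG[w wE] : I (v2 ord0 ord0 * u).
      have := mx11_addM v1 (aug F) v2 u; rewrite v0 mxE => /esym/eqP.
      rewrite addrC addr_eq0 => /eqP ->.
      by apply: IN; apply/rF; exists v1.
    by exists w; apply/rowP=> j; rewrite ord1.
  + move=> i; change (exact_at (cone_dif phi i.+1) (cone_dif phi i)).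
    case: i => [|i]; apply: exact_at_block => //; try exact: rFS; try exact: rGS.
    * by rewrite phiE addNr.
    * by rewrite phiE addNr.
- by case=> [|i]; apply: homog_block.
- apply/homog_mxP=> i j; rewrite mxE; case: split => k; first by move/homog_mxP: hauF.
  by move/homog_mxP: hu1.
Qed.

(** * Monomial ideals and their colon ideals *)

Lemma ideal_gen_mem (A : S -> Prop) g : A g -> ideal_gen A g.
Proof. by exists 1, (fun=> 1), (fun=> g); split=> //; rewrite big_ord1 mul1r. Qed.

Lemma ideal_gen0 (A : S -> Prop) : ideal_gen A 0.
Proof. by exists 0, (fun=> 0), (fun=> 0); split=> [[]|]; rewrite ?big_ord0. Qed.

Lemma ideal_genD (A : S -> Prop) p q : ideal_gen A p -> ideal_gen A q -> ideal_gen A (p + q).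
Proof.
move=> [k [c [g [Ag ->]]]] [l [d [h [Ah ->]]]].
pose glue (f : 'I_k -> S) (f' : 'I_l -> S) i :=
  match split i with inl j => f j | inr j => f' j end.
exists (k + l)%N, (glue c d), (glue g h); split=> [i|].
  by rewrite /glue; case: split.
rewrite big_split_ord; congr (_ + _); apply: eq_bigr => i _; rewrite /glue.
  by rewrite (unsplitK (inl i)).
by rewrite (unsplitK (inr i)).
Qed.

Lemma ideal_genM (A : S -> Prop) p q : ideal_gen A q -> ideal_gen A (p * q).
Proof.
move=> [k [c [g [Ag ->]]]]; exists k, (fun i => p * c i), g; split=> //.
by rewrite mulr_sumr; apply: eq_bigr => i _; rewrite mulrA.
Qed.

Lemma ideal_gen_sum (A : S -> Prop) (J : Type) (r : seq J) (P : pred J) (F : J -> S) :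
  (forall j, P j -> ideal_gen A (F j)) -> ideal_gen A (\sum_(j <- r | P j) F j).
Proof. by move=> AF; elim/big_ind: _ => //; [exact: ideal_gen0 | exact: ideal_genD]. Qed.

Lemma ideal_gen_sub (A B : S -> Prop) p :
  (forall g, A g -> ideal_gen B g) -> ideal_gen A p -> ideal_gen B p.
Proof.
move=> AB [k [c [g [Ag ->]]]]; apply: ideal_gen_sum => i _.
by apply: ideal_genM; apply: AB.
Qed.

Implicit Types (s : seq 'X_{1..n}) (m u : 'X_{1..n}).

Lemma monomial_gen_X s m : has (fun u => (u <= m)%MM) s -> monomial_gen s ('X_[m] : S).
Proof.
case/hasP=> u us um; rewrite -(submK um) mpolyXD; apply: ideal_genM.
by apply: ideal_gen_mem; exists u.
Qed.

Lemma monomial_genP s (p : S) :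
  monomial_gen s p <-> {in msupp p, forall m, has (fun u => (u <= m)%MM) s}.
Proof.
split=> [[k [c [g [gs ->]]]] m /msupp_sum_le|ps].
  case/flatten_mapP=> i _; have [u us ->] := gs i.
  rewrite (perm_mem (msuppMX _ _)) => /mapP[v _ ->].
  by apply/hasP; exists u; rewrite // lem_addr.
rewrite [p]mpolyE big_seq; apply: ideal_gen_sum => m mp.
by rewrite -mul_mpolyC; apply: ideal_genM; apply: monomial_gen_X; apply: ps.
Qed.

Lemma monomial_genMX s u (p : S) :
  monomial_gen s (p * 'X_[u]) <->
  {in msupp p, forall m, has (fun v => (v <= m + u)%MM) s}.
Proof.
rewrite monomial_genP; split=> ps m.
  by move=> mp; apply: ps; rewrite (perm_mem (msuppMX _ _)) addmC map_f.
by rewrite (perm_mem (msuppMX _ _)) => /mapP[v vp ->]; rewrite addmC ps.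
Qed.

Lemma eq_monomial_gen s s' : s =i s' -> eq_ideal (K := K) (monomial_gen s) (monomial_gen s').
Proof.
by move=> ss' p; rewrite !monomial_genP; split=> ps m /ps; rewrite (eq_has_r ss').
Qed.

Lemma monomial_gen_cons u s (p : S) :
  monomial_gen (u :: s) p <-> exists q, monomial_gen s (p - q * 'X_[u]).
Proof.
split=> [/monomial_genP ps|[q sq]].
  (* The witness collects the terms of [p] divisible by ['X_[u]], divided by it. *)
  exists (\sum_(m <- msupp p | (u <= m)%MM) p@_m *: 'X_[m - u]).
  rewrite {1}[p]mpolyE (bigID (fun m => (u <= m)%MM)) /= mulr_suml -addrA addrCA.
  rewrite -sumrB [X in _ + X]big1 ?addr0.
    rewrite big_seq_cond; apply: ideal_gen_sum => m /andP[mp um].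
    rewrite -mul_mpolyC; apply: ideal_genM; apply: monomial_gen_X.
    by have /= := ps m mp; rewrite (negPf um).
  by move=> m um; rewrite -scalerAl -mpolyXD submK // subrr.
rewrite -(subrK (q * 'X_[u]) p); apply: ideal_genD.
  by apply: ideal_gen_sub sq => g [m ms ->]; apply: ideal_gen_mem; exists m; rewrite // inE ms orbT.
by apply: ideal_genM; apply: ideal_gen_mem; exists u; rewrite ?mem_head.
Qed.

Lemma colon_monomial s u (p : S) :
  colon (monomial_gen s) (monomial_gen [:: u]) p <-> monomial_gen s (p * 'X_[u]).
Proof.
split=> [|sp q [k [c [g [gu ->]]]]]; first by apply; apply: ideal_gen_mem; exists u; rewrite ?mem_head.
rewrite mulr_sumr; apply: ideal_gen_sum => i _; have [m /[!inE]/eqP-> ->] := gu i.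
by rewrite mulrCA; apply: ideal_genM.
Qed.

Definition variables_in (V : {set 'I_n}) : S -> Prop :=
  fun p => exists2 j, j \in V & p = 'X_j.

Lemma variables_genE V (p : S) :
  ideal_gen (variables_in V) p <-> monomial_gen [seq U_(j)%MM | j <- enum V] p.
Proof.
split; apply: ideal_gen_sub => g.
  case=> j jV ->; apply: ideal_gen_mem; exists U_(j)%MM => //.
  by rewrite map_f ?mem_enum.
case=> m /mapP[j + ->] ->; rewrite mem_enum => jV.
by apply: ideal_gen_mem; exists j.
Qed.

Lemma variables_genP V (p : S) :
  ideal_gen (variables_in V) p <->
  {in msupp p, forall m : 'X_{1..n}, [exists j in V, 0 < m j]%N}.
Proof.
have hasE m : has (fun u => (u <= m)%MM) [seq U_(j)%MM | j <- enum V] = [exists j in V, 0 < m j]%N.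
  apply/hasP/exists_inP=> [[_ /mapP[j + ->] /mnm_lepP/(_ j)]|[j jV mj]].
    by rewrite mem_enum mnm1E eqxx; exists j.
  exists U_(j)%MM; first by rewrite map_f ?mem_enum.
  by apply/mnm_lepP=> i; rewrite mnm1E; case: eqVneq => // <-.
by rewrite variables_genE monomial_genP; split=> ps m /ps; rewrite hasE.
Qed.

(** * Linear resolutions from linear quotients *)

Lemma variables_linear_resolution (s : seq 'I_n) : uniq s ->
  exists F, linear_free_resolution 1 F (monomial_gen [seq U_(j)%MM | j <- s]).
Proof.
elim: s => [_|j s IHs /= /andP[js /IHs[F hF]]].
  have [F hF] := zero_linear_free_resolution 1; exists F.
  apply: eq_linear_free_resolution hF => p; rewrite monomial_genP.
  split=> [-> m|p0]; first by rewrite msupp0.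
  by apply/msuppnil0; case: (msupp p) p0 => // m r /(_ m (mem_head _ _)).
have [||H hH] := cone_linear_free_resolution (u := 'X_j) (G := F) _ hF.
- by rewrite dhomogX /= mdeg1.
(* [F] also resolves the colon ideal: a variable of [s] dividing [m + U_(j)] already divides [m], as
   [j] is not in [s]. *)
- apply: eq_linear_free_resolution hF => p; rewrite monomial_genMX monomial_genP.
  split=> ps m /ps /hasP[_ /mapP[i si ->] /mnm_lepP mi]; apply/hasP; exists U_(i)%MM; rewrite ?map_f //.
    by apply: lepm_trans (lem_addr _ _); apply/mnm_lepP.
  apply/mnm_lepP=> k; have := mi k; rewrite mnmDE !mnm1E.
  case: (eqVneq i k) => // ik; rewrite -ik; case: eqVneq => [ji|]; last by rewrite addn0.
  by rewrite ji si in js.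
exists H; apply: eq_linear_free_resolution hH => p.
by rewrite -monomial_gen_cons.
Qed.

(** Each generator added to a prefix of [s] costs one cone, its colon ideal being resolved by
    [variables_linear_resolution]. *)
Lemma linear_quotients_linear_free_resolution t s :
  {in s, forall m, mdeg m = t} ->
  (forall i, (i < size s)%N -> exists V, forall p : S,
     monomial_gen (take i s) (p * 'X_[nth 0%MM s i]) <-> ideal_gen (variables_in V) p) ->
  exists F, linear_free_resolution t F (monomial_gen s).
Proof.
move=> st sV; rewrite -(take_size s); elim: {-2}(size s) (leqnn (size s)) => [_|k IHk ks].
  have [F hF] := zero_linear_free_resolution t; exists F.
  apply: eq_linear_free_resolution hF => p; rewrite take0 monomial_genP.
  split=> [-> m|p0]; first by rewrite msupp0.
  by apply/msuppnil0; case: (msupp p) p0 => // m r /(_ m (mem_head _ _)).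
have [F hF] := IHk (ltnW ks); have [V hV] := sV k ks.
have [G hG] := variables_linear_resolution (enum_uniq V).
have [||H hH] := cone_linear_free_resolution (u := 'X_[nth 0%MM s k]) (G := G) _ hF.
- by rewrite dhomogX /= st // mem_nth.
- by apply: eq_linear_free_resolution hG => p; rewrite -variables_genE hV.
exists H; apply: eq_linear_free_resolution hH => p; rewrite -monomial_gen_cons.
by apply: eq_monomial_gen => m; rewrite (take_nth 0%MM ks) mem_rcons.
Qed.

Lemma linear_free_resolution_linear t (A : S -> Prop) F :
  (forall g, A g -> g \is t.-homog) ->
  linear_free_resolution t F (ideal_gen A) -> linear_resolution t (ideal_gen A).
Proof.
move=> homA [resF dgF /(_ _)/homog_mxP difF /homog_mxP augF]; split=> [p|].
  split; apply: ideal_gen_sub => g; last by case.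
  by move=> Ag; apply: ideal_gen_mem; split; [exact: ideal_gen_mem | exact: homA].
exists (fun i j => #|[set a : 'I_(rk F i) | dg a == j]|); split; last first.
  by move=> i j ij; apply: eq_card0 => a; rewrite inE dgF; apply/eqP=> /esym.
exists F; split=> //; split=> //; last first.
  by move=> i a b; apply: (dhomog_nemf_coeff (difF i a b)); rewrite /= mdeg0.
split=> [i a b m mab|b]; last by rewrite dgF.
by rewrite !dgF (dhomog_mf (difF i a b) mab).
Qed.

End LinearResolutions.

(** * The ideal of connected sets *)

Section Monomials.
Variables (K : fieldType) (T : finType).

Definition set_mnm (C : {set T}) : 'X_{1..#|T|} := (\sum_(c in C) U_(enum_rank c))%MM.

Lemma set_mnmE C i : set_mnm C i = (enum_val i \in C).
Proof.
rewrite mnm_sumE (eq_bigr (fun c => (c == enum_val i) : nat)); last first.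
  by move=> c _; rewrite mnm1E -(inj_eq enum_val_inj) enum_rankK.
case: (boolP (enum_val i \in C)) => iC.
  rewrite (bigD1 (enum_val i)) //= eqxx big1 // => c /andP[_ /negPf->] //.
by rewrite big1 // => c cC; case: eqP iC => // <-; rewrite cC.
Qed.

Lemma mdeg_set_mnm C : mdeg (set_mnm C) = #|C|.
Proof. by rewrite mdeg_sum (eq_bigr (fun=> 1%N)) ?sum1_card // => c _; rewrite mdeg1. Qed.

Lemma x_setE C : x_set K C = 'X_[set_mnm C].
Proof.
by rewrite /x_set /set_mnm (big_morph (fun m => 'X_[m]) (@mpolyXD _ K) (@mpolyX0 _ K)).
Qed.

Lemma set_mnm_inj : injective set_mnm.
Proof.
move=> A B AB; apply/setP=> x; have := congr1 (fun m : 'X_{1..#|T|} => m (enum_rank x)) AB.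
by rewrite /= !set_mnmE enum_rankK => /(can_inj oddb).
Qed.

Lemma lem_mdeg_eq n (u m : 'X_{1..n}) : (u <= m)%MM -> mdeg u = mdeg m -> u = m.
Proof.
move=> um; rewrite -{1}(submK um) mdegD -{1}[mdeg u]add0n => /addIn/esym/eqP.
by rewrite mdeg_eq0 => /eqP um0; rewrite -(submK um) um0 add0m.
Qed.

Lemma connected_idealE (e : rel T) t (u : seq {set T}) :
  (forall C, C \in u <-> t_connected e t C) ->
  eq_ideal (connected_ideal K e t) (monomial_gen [seq set_mnm C | C <- u]).
Proof.
move=> uP p; split; apply: ideal_gen_sub => g.
  move=> [C /uP Cu ->]; apply: ideal_gen_mem; exists (set_mnm C); last exact: x_setE.
  by rewrite map_f.
move=> [m /mapP[C /uP Cu ->] ->]; apply: ideal_gen_mem; exists C => //.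
by rewrite x_setE.
Qed.

(* For squarefree monomials of the same degree, colon ideals generated by
   variables amount to an exchange property of the supports. *)
Lemma exchange_colon (u : seq {set T}) (B : {set T}) :
  (forall A, A \in u -> exists w, [/\ w \in A, w \notin B
     & exists2 C, C \in u & w \in C /\ C \subset w |: B]) ->
  exists V, forall p : {mpoly K[#|T|]},
    monomial_gen [seq set_mnm C | C <- u] (p * 'X_[set_mnm B]) <->
    ideal_gen (variables_in V) p.
Proof.
move=> exch.
(* [V] collects the vertices that are the only vertex outside [B] of some member of [u]. *)
exists [set j | (enum_val j \notin B) &&
  has (fun C : {set T} => (enum_val j \in C) && (C \subset enum_val j |: B)) u] => p.
rewrite monomial_genMX variables_genP; split=> ps m /ps.
  case/hasP=> _ /mapP[A Au ->] /mnm_lepP Am.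
  have [w [wA wB [C Cu CB]]] := exch A Au.
  apply/exists_inP; exists (enum_rank w).
    by rewrite inE enum_rankK wB; apply/hasP; exists C => //; apply/andP.
  (* As [B] does not supply [w], the monomial [m] has to. *)
  by have := Am (enum_rank w); rewrite mnmDE !set_mnmE enum_rankK wA (negPf wB) addn0.
case/exists_inP=> j; rewrite inE => /andP[jB /hasP[C Cu /andP[jC CB]]] mj.
apply/hasP; exists (set_mnm C); first exact: map_f.
apply/mnm_lepP=> i; rewrite mnmDE !set_mnmE.
case: (boolP (enum_val i \in C)) => //= /(subsetP CB) /setU1P[/enum_val_inj->|->].
  by rewrite (leq_trans mj) // leq_addr.
by rewrite leq_addl.
Qed.

End Monomials.

Theorem theorem6p2 (t : nat) (ht : (3 <= t)%N) (K : fieldType)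
    (T : finType) (e : rel T) (e_sym : ssrbool.symmetric e) (e_irr : irreflexive e)
    (hgap : gap_free e) (hclaw : claw_free e t) :
  linear_quotients (connected_ideal K e t) /\
  linear_resolution t (connected_ideal K e t).
Proof.
have [u [u_uniq uP u_exch]] := connected_sets_order e_sym e_irr (ltnW ht) hgap hclaw.
pose s := [seq set_mnm C | C <- u].
have IE := connected_idealE (K := K) uP.
have sz_s : size s = size u by rewrite size_map.
have s_deg : {in s, forall m, mdeg m = t}.
  by move=> _ /mapP[C /uP[Ct _] ->]; rewrite mdeg_set_mnm.
have colonV i : (i < size s)%N -> exists V, forall p : {mpoly K[#|T|]},
    monomial_gen (take i s) (p * 'X_[nth 0%MM s i]) <-> ideal_gen (variables_in V) p.
  rewrite sz_s => iu; rewrite -map_take (nth_map set0) //.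
  by apply: exchange_colon => A; apply: u_exch.
split; last first.
  have [F hF] := linear_quotients_linear_free_resolution s_deg colonV.
  apply: linear_free_resolution_linear; last first.
    by apply: eq_linear_free_resolution hF => p; apply: iff_sym; apply: IE.
  by move=> _ [C [Ct _] ->]; rewrite x_setE dhomogX /= mdeg_set_mnm Ct.
exists s; split=> [|i /andP[_ /colonV[V hV]]]; last first.
  by exists V => p; rewrite colon_monomial hV.
split=> [|//|s' s's IE' m ms]; first by rewrite (map_inj_uniq (@set_mnm_inj T)).
have /IE'/monomial_genP/(_ m) : connected_ideal K e t 'X_[m].
  by apply/IE; apply: ideal_gen_mem; exists m.
rewrite msuppX mem_head => /(_ isT)/hasP[m' m's' m'm].
by have <- : m' = m; rewrite // (lem_mdeg_eq m'm) // !s_deg // s's.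
Qed.
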